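(* There is no distance-regular graph with intersection array $\{32,27,9,1;1,3,27,32\}$.
   Context: A connected graph of diameter $d$ is distance-regular with intersection array $\{b_0,\dots,b_{d-1};c_1,\dots,c_d\}$ if for all $i$ and all vertices $v,w$ at distance $i$, $w$ has exactly $b_i$ neighbours at distance $i+1$ from $v$ and exactly $c_i$ neighbours at distance $i-1$ from $v$. *)

(* Defs.v *)
From mathcomp Require Import all_boot.
Set Implicit Arguments. Unset Strict Implicit. Unset Printing Implicit Defensive.

Definition simple_graph (T : finType) (e : rel T) : Prop :=
  symmetric e /\ irreflexive e.

Fixpoint within (T : finType) (e : rel T) (n : nat) (x y : T) : bool :=
  match n with
  | 0 => x == y
  | n'.+1 => (x == y) || [exists z, e x z && within e n' z y]
  end.

(* Graph distance: the least n with a walk of length <= n from x to y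
   (every reachable vertex is reachable within #|T| steps); if y is not
   reachable from x the value is irrelevant since we assume connectivity. *)
Definition gdist (T : finType) (e : rel T) (x y : T) : nat :=
  find (fun n => within e n x y) (iota 0 #|T|).

Definition connected_graph (T : finType) (e : rel T) : Prop :=
  forall x y : T, connect e x y.

(* Distance-regular graph of diameter d = size b = size c with intersection
   array {b_0,...,b_{d-1}; c_1,...,c_d}, where b = [:: b_0; ...; b_{d-1}]
   and c = [:: c_1; ...; c_d]. *)
Definition distance_regular (T : finType) (e : rel T) (b c : seq nat) : Prop :=
  let d := size b in
  [/\ simple_graph e, connected_graph e, size c = d,
      (forall x y : T, gdist e x y <= d) /\ (exists x y : T, gdist e x y = d) &
      forall (v w : T) (i : nat), gdist e v w = i ->
        (i < d -> #|[set u | e w u & gdist e v u == i.+1]| = nth 0 b i) /\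
        (1 <= i <= d -> #|[set u | e w u & gdist e v u == i.-1]| = nth 0 c i.-1)].

(* Main.v *)
Require Import Defs.
From mathcomp Require Import all_boot.
From mathcomp Require Import order ssralg ssrnum ssrint zify ring.
Set Implicit Arguments. Unset Strict Implicit. Unset Printing Implicit Defensive.

(* Identifying antipodal vertices folds the graph to a strongly regular graph
   with parameters (105, 32, 4, 12), whose adjacency matrix A satisfies
   (A - 2)^2 = -12 (A - 2) + 12 J. For an integer weight f on its vertices,
   g = (A - 2) f is therefore an integer vector whose sum and sum of squares are
   determined by the total of f and by <f, g>, and sum (g - c)(g - c - 1) >= 0
   for every integer c bounds <f, g> from above. With suitable weights this
   shows that the neighbourhood of a vertex x has girth at least 6, that each
   neighbour y of x determines a vertex w, not adjacent to x, whose common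
   neighbours with x are the vertices at distance 2 from y in the neighbourhood
   of x, and (as these common neighbours span no edge) that at most 8 vertices w
   occur. So some w comes from at least 4 neighbours y; these
   and the common neighbours of x and w are 16 vertices that form one half P of
   a bipartition of the neighbourhood of x.
   In the cover, let j(v) be the number of neighbours of v in the lift of P.
   Counting over the 288 vertices v at distance 2 from x gives
   sum (j(v) - 1)(j(v) - 2) = 0, so j(v) is 1 or 2; but c_2 = 3 forces
   j(v) = 3 for any v lying over w. *)

(** * Integer weights on a strongly regular graph with parameters (105, 32, 4, 12) *)

Section StronglyRegular.
Import GRing.Theory Num.Theory.
Local Open Scope ring_scope.

Variables (V : finType) (a : rel V) (x0 : V).
Hypothesis a_sym : symmetric a.
Hypothesis a_irr : irreflexive a.

Definition nbr x := [set y | a x y].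

Hypothesis degree : forall x, #|nbr x| = 32%N.
Hypothesis lambda : forall x y, a x y -> #|nbr x :&: nbr y| = 4%N.
Hypothesis mu : forall x y, x != y -> ~~ a x y -> #|nbr x :&: nbr y| = 12%N.

Implicit Types (f : V -> int) (S : {set V}) (x y z u v w : V) (c : int).

Definition total f := \sum_z f z.
Definition adj f z := \sum_(u | a z u) f u.
(** The shift by 2 is chosen because A has eigenvalues 32, 2 and -10: [lapl] kills the eigenspace of
    2, leaving the eigenvalues 30 and -12. *)
Definition lapl f z := adj f z - 2 * f z.
Definition form f := \sum_z f z * lapl f z.

Lemma natr_card (p : pred V) : \sum_(z | p z) (1 : int) = #|p|%:R.
Proof. rewrite sumr_const; congr (_ *+ _); exact: eq_card. Qed.

(** Entrywise form of A^2 = 20 - 8 A + 12 J, merging the three parameters: 32 = 20 + 12, 4 = -8 +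
    12, and 12. *)
Lemma card_common u z : #|nbr u :&: nbr z|%:R =
  20 * (u == z)%:R - 8 * (a u z)%:R + 12 :> int.
Proof.
case: eqVneq => [->|uz]; first by rewrite setIid degree a_irr.
by case auz: (a u z); [rewrite lambda | rewrite mu ?auz].
Qed.

Lemma sum_delta x (h : V -> int) : \sum_z (z == x)%:R * h z = h x.
Proof.
rewrite (bigD1 x) //= eqxx mul1r big1 ?addr0 // => z /negPf ->.
by rewrite mul0r.
Qed.

Lemma sum_adj f h : \sum_z adj f z * h z = \sum_z f z * adj h z.
Proof.
under eq_bigr => z _ do rewrite big_distrl.
under [RHS]eq_bigr => z _ do rewrite big_distrr.
rewrite [LHS](exchange_big_dep xpredT) //=.
by apply: eq_bigr => z _; apply: eq_bigl => u; rewrite a_sym.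
Qed.

Lemma total_adj f : total (adj f) = 32 * total f.
Proof.
rewrite /total /adj (exchange_big_dep xpredT) //= mulr_sumr.
apply: eq_bigr => u _; rewrite sumr_const.
rewrite (_ : #|_| = 32%N); first by ring.
by rewrite -(degree u); apply: eq_card => z; rewrite inE -topredE /= a_sym.
Qed.

Lemma adj_adj f z : adj (adj f) z = 20 * f z - 8 * adj f z + 12 * total f.
Proof.
rewrite {1}/adj (exchange_big_dep xpredT) //=.
have -> : \sum_u \sum_(y | a z y && a y u) f u =
  \sum_u (20 * ((u == z)%:R * f u) - 8 * ((a u z)%:R * f u) + 12 * f u).
  apply: eq_bigr => u _; rewrite sumr_const -[LHS]mulr_natl.
  rewrite (_ : #|_| = #|nbr u :&: nbr z|); last first.
    by apply: eq_card => y; rewrite !inE unfold_in andbC a_sym.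
  by rewrite card_common; ring.
rewrite big_split sumrB /= -!mulr_sumr sum_delta; congr (_ - _ * _ + _).
rewrite /adj [RHS]big_mkcond; apply: eq_bigr => u _.
by rewrite a_sym; case: (a z u); rewrite ?mul1r ?mul0r.
Qed.

Lemma adj_cst c z : adj (fun=> c) z = 32 * c.
Proof.
rewrite /adj sumr_const (_ : #|_| = 32%N); first by ring.
by rewrite -(degree z); apply: eq_card => u; rewrite inE.
Qed.

(** Applying A^2 to the constant weight 1 gives 32^2 = 20 - 8 * 32 + 12 n, where n is the number of
    vertices. *)
Lemma card_V : #|V| = 105%N.
Proof.
have := adj_adj (fun=> 1) x0; rewrite adj_cst.
have -> : adj (adj (fun=> 1)) x0 = 32 * 32.
  by rewrite -(adj_cst _ x0) /adj; apply: eq_bigr => u _; rewrite -/(adj _ u) adj_cst.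
by rewrite /total natr_card (eq_card (B := V)) // => h; lia.
Qed.

Lemma total_lapl f : total (lapl f) = 30 * total f.
Proof.
have -> : total (lapl f) = total (adj f) - 2 * total f.
  by rewrite /total mulr_sumr -sumrB.
rewrite total_adj; ring.
Qed.

Lemma sum_lapl_sqr f :
  \sum_z lapl f z ^+ 2 = 12 * total f ^+ 2 - 12 * form f.
Proof.
have -> : \sum_z lapl f z ^+ 2 =
    \sum_z adj f z * adj f z + (- 4) * \sum_z f z * adj f z
      + 4 * \sum_z f z ^+ 2.
  rewrite !mulr_sumr -!big_split; apply: eq_bigr => z _; rewrite /lapl /=; ring.
rewrite sum_adj.
have -> : form f = \sum_z f z * adj f z - 2 * \sum_z f z ^+ 2.
  rewrite mulr_sumr -sumrB; apply: eq_bigr => z _; rewrite /lapl; ring.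
have -> : \sum_z f z * adj (adj f) z =
    20 * \sum_z f z ^+ 2 - 8 * \sum_z f z * adj f z + 12 * total f ^+ 2.
  rewrite expr2 [X in 12 * (X * _)]/total !mulr_suml !mulr_sumr -sumrB -big_split.
  by apply: eq_bigr => z _ /=; rewrite adj_adj; ring.
ring.
Qed.

Lemma sum_window f c : \sum_z (lapl f z - c) * (lapl f z - c - 1) =
  12 * total f ^+ 2 - 12 * form f - 30 * (2 * c + 1) * total f
    + 105 * c * (c + 1).
Proof.
have -> : \sum_z (lapl f z - c) * (lapl f z - c - 1) =
    \sum_z lapl f z ^+ 2 - (2 * c + 1) * total (lapl f)
      + c * (c + 1) * \sum_(z : V) 1.
  rewrite /total !mulr_sumr -sumrB -big_split.
  by apply: eq_bigr => z _ /=; ring.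
rewrite sum_lapl_sqr total_lapl natr_card (eq_card (B := V)) // card_V; ring.
Qed.

Lemma window_ge0 (m c : int) : 0 <= (m - c) * (m - c - 1).
Proof.
case: (lerP (m - c) 0) => h; first by apply: mulr_le0; lia.
by apply: mulr_ge0; lia.
Qed.

(** No integer lies strictly between [c] and [c + 1], so each window term is nonnegative. As
    [lapl f] has mean 30 s / 105 = 2 s / 7 for total s, the useful [c] is the integer part of 2 s /
    7. *)
Lemma form_bound f c : 12 * form f <=
  12 * total f ^+ 2 - 30 * (2 * c + 1) * total f + 105 * c * (c + 1).
Proof.
have : 0 <= \sum_z (lapl f z - c) * (lapl f z - c - 1).
  by apply: sumr_ge0 => z _; apply: window_ge0.
by rewrite sum_window; move: (form f) (total f) => F s; lia.
Qed.

(** Weights are built as iterated shifts of some [chi S], so that [total], [form] and [lapl] reduce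
    by rewriting to adjacencies. *)
Definition shift f c w := fun z => f z + c * (z == w)%:R.

Definition chi S : V -> int := fun z => (z \in S)%:R.

Lemma total_shift f c w : total (shift f c w) = total f + c.
Proof.
rewrite /total big_split /= -mulr_sumr -{2}[c]mulr1.
rewrite -[X in _ = _ + c * X](sum_delta w (fun=> 1)); congr (_ + _ * _).
by apply: eq_bigr => z _; rewrite mulr1.
Qed.

Lemma lapl_shift f c w z :
  lapl (shift f c w) z = lapl f z + c * (a z w)%:R - 2 * c * (z == w)%:R.
Proof.
rewrite /lapl /adj big_split -mulr_sumr /=.
have -> : \sum_(u | a z u) (u == w)%:R = (a z w)%:R :> int.
  rewrite -(sum_delta w (fun u => (a z u)%:R)) big_mkcond /=.
  by apply: eq_bigr => u _; case: (a z u); rewrite ?mulr1 ?mulr0.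
rewrite /shift; ring.
Qed.

Lemma form_sym f h : \sum_z h z * lapl f z = \sum_z f z * lapl h z.
Proof.
have E (f1 f2 : V -> int) : \sum_z f1 z * lapl f2 z =
    \sum_z f1 z * adj f2 z - 2 * \sum_z f1 z * f2 z.
  by rewrite mulr_sumr -sumrB; apply: eq_bigr => z _; rewrite /lapl; ring.
rewrite !E -sum_adj; congr (_ - 2 * _); apply: eq_bigr => z _; exact: mulrC.
Qed.

Lemma form_shift f c w :
  form (shift f c w) = form f + 2 * c * lapl f w - 2 * c ^+ 2.
Proof.
have E h : \sum_z shift f c w z * h z = \sum_z f z * h z + c * h w.
  rewrite -(sum_delta w) mulr_sumr -big_split.
  by apply: eq_bigr => z _; rewrite /shift /=; ring.
rewrite /form E form_sym E lapl_shift a_irr eqxx /form /=; ring.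
Qed.

Lemma total_chi S : total (chi S) = #|S|%:R.
Proof.
rewrite -sum1_card natr_sum [RHS]big_mkcond.
by apply: eq_bigr => z _; rewrite /chi; case: (z \in S).
Qed.

Lemma lapl_chi S z : lapl (chi S) z = #|nbr z :&: S|%:R - 2 * (z \in S)%:R.
Proof.
congr (_ - _); rewrite -sum1_card natr_sum /adj big_mkcond [RHS]big_mkcond.
by apply: eq_bigr => u _; rewrite !inE /chi; case: (a z u); case: (u \in S).
Qed.

Lemma form_chi S : form (chi S) = \sum_(z in S) lapl (chi S) z.
Proof.
rewrite /form [RHS]big_mkcond; apply: eq_bigr => z _.
by rewrite /chi; case: (z \in S); rewrite ?mul1r ?mul0r.
Qed.


Lemma adj_lapl f z : adj (lapl f) z = 12 * total f - 10 * lapl f z.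
Proof.
have -> : adj (lapl f) z = adj (adj f) z - 2 * adj f z.
  by rewrite /adj mulr_sumr -sumrB.
by rewrite adj_adj /lapl; ring.
Qed.

(* Such an f is a root (norm 2) of the even lattice of weights with total
   divisible by 7. Then lapl f - 2 is an eigenvector for -10 with 12 entries 1,
   12 entries -1 and all others 0, and U, the set of the 1's, is a coclique. *)
Lemma no_root f : total f = 7 -> form f = 12 -> False.
Proof.
move=> s7 F12.
have ub z : lapl f z <= 3.
  by have := form_bound (shift f 1 z) 2; rewrite total_shift form_shift s7 F12; lia.
have lb z : 1 <= lapl f z.
  by have := form_bound (shift f (-1) z) 1; rewrite total_shift form_shift s7 F12; lia.
pose U := [set z | lapl f z == 3]; pose W := [set z | lapl f z == 1].
(* At c = 1 the window vanishes on the values 1 and 2 and equals 2 on the value 3; the window sum is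
   24. For [W], c = 2 plays the same role. *)
have cardU : (#|U|%:R : int) = 12.
  have := sum_window f 1; rewrite s7 F12.
  have -> : \sum_z (lapl f z - 1) * (lapl f z - 1 - 1) = 2 * total (chi U).
    rewrite /total mulr_sumr; apply: eq_bigr => z _; rewrite /chi inE.
    have := ub z; have := lb z.
    have [->//|n3 g1 g3] := eqVneq (lapl f z) 3.
    have /orP[/eqP->|/eqP->] // : (lapl f z == 1) || (lapl f z == 2) by lia.
  rewrite total_chi; lia.
have cardW : (#|W|%:R : int) = 12.
  have := sum_window f 2; rewrite s7 F12.
  have -> : \sum_z (lapl f z - 2) * (lapl f z - 2 - 1) = 2 * total (chi W).
    rewrite /total mulr_sumr; apply: eq_bigr => z _; rewrite /chi inE.
    have := ub z; have := lb z.
    have [->//|n1 g1 g3] := eqVneq (lapl f z) 1.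
    have /orP[/eqP->|/eqP->] // : (lapl f z == 3) || (lapl f z == 2) by lia.
  rewrite total_chi; lia.
have lU z : lapl f z = 2 + chi U z - chi W z.
  have := ub z; have := lb z; rewrite /chi !inE => g1 g3.
  have /or3P[/eqP->|/eqP->|/eqP->] // : [|| lapl f z == 1, lapl f z == 3 | lapl f z == 2].
  by lia.
have degU z : #|nbr z :&: U|%:R - #|nbr z :&: W|%:R = 20 - 10 * lapl f z :> int.
  have := adj_lapl f z; rewrite s7.
  have -> : adj (lapl f) z = 2 * 32 + #|nbr z :&: U|%:R - #|nbr z :&: W|%:R.
    have E S : #|nbr z :&: S|%:R = adj (chi S) z.
      by have := lapl_chi S z; rewrite /lapl /chi; lia.
    have -> : 2 * 32 = adj (fun=> 2) z by rewrite adj_cst.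
    rewrite !E /adj -big_split -sumrB; apply: eq_bigr => u _; exact: lU.
  lia.
(* By [degU], adjacent z and z' in [U] would each have at least 10 neighbours among the 12 vertices
   of [W], hence at least 8 common ones, against lambda = 4. *)
have U_indep z z' : z \in U -> z' \in U -> ~~ a z z'.
  move=> zU z'U; apply/negP => azz'.
  have := lambda azz'; have := degU z; have := degU z'.
  move: zU z'U; rewrite !inE => /eqP -> /eqP ->.
  have := subset_leq_card (subsetIr (nbr z :&: W) (nbr z' :&: W)).
  have := cardsUI (nbr z :&: W) (nbr z' :&: W).
  have : (#|(nbr z :&: W) :|: (nbr z' :&: W)| <= #|W|)%N.
    by apply: subset_leq_card; rewrite subUset !subsetIr.
  have : (#|(nbr z :&: W) :&: (nbr z' :&: W)| <= #|nbr z :&: nbr z'|)%N.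
    by apply: subset_leq_card; apply: setISS; apply: subsetIl.
  lia.
have gU z : z \in U -> lapl (chi U) z = - 2.
  move=> zU; rewrite lapl_chi zU (_ : _ :&: _ = set0) ?cards0 //.
  apply/setP => u; rewrite !inE; apply/negP => /andP[azu gu].
  by have := U_indep z u zU; rewrite inE gu azu => /(_ isT).
have FU : form (chi U) = - 24.
  rewrite form_chi (eq_bigr (fun=> - 2)) => [|z /gU //].
  by rewrite sumr_const -[LHS]mulr_natr cardU.
(* The window sum is 756, but each vertex of [U] contributes (-5)(-6) = 30 and each vertex of [W] at
   least 7 * 6 = 42, in all at least 864. *)
have := sum_window (chi U) 3; rewrite FU total_chi cardU.
suff : 30 * total (chi U) + 42 * total (chi W) <=
    \sum_z (lapl (chi U) z - 3) * (lapl (chi U) z - 3 - 1).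
  rewrite !total_chi cardU cardW; move: (\sum_z _) => q; lia.
rewrite /total !mulr_sumr -big_split; apply: ler_sum => z _ /=.
case zU : (z \in U).
  rewrite gU // /chi zU; move: zU; rewrite !inE => /eqP -> //.
case zW : (z \in W); last by rewrite /chi zU zW; exact: window_ge0.
have : 10 <= lapl (chi U) z.
  rewrite lapl_chi zU; have := degU z.
  by move: zW; rewrite inE => /eqP ->; lia.
by rewrite /chi zU zW; move: (lapl _ _) => g g10; nia.
Qed.


(** * Short cycles in neighbourhoods *)

Lemma chi0E : (total (chi set0) = 0) * (form (chi set0) = 0) *
  (forall z, lapl (chi set0) z = 0).
Proof.
split=> [|z]; last by rewrite lapl_chi setI0 cards0 inE.
by split; [rewrite total_chi cards0 | rewrite form_chi big_set0].
Qed.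

Lemma adj_neq x y : a x y -> (x == y) = false.
Proof. by move=> axy; apply: contraTF axy => /eqP ->; rewrite a_irr. Qed.

Definition shiftE := (total_shift, form_shift, lapl_shift, chi0E).

Local Opaque shift chi.

(** The indicator of a 4-clique has total 4 and form 4, while the bound with c = 1 reads 12 * form
    <= 42. *)
Lemma no_K4 x y z t :
  a x y -> a x z -> a x t -> a y z -> a y t -> a z t -> False.
Proof.
move=> xy xz xt yz yt zt.
have := form_bound (shift (shift (shift (shift (chi set0) 1 t) 1 z) 1 y) 1 x) 1.
rewrite !shiftE xy xz xt yz yt zt !(adj_neq xy, adj_neq xz, adj_neq xt,
  adj_neq yz, adj_neq yt, adj_neq zt).
by vm_compute.
Qed.

(** The indicator of hub and rim has total 5 and form 2 * 8 - 2 * 5 = 6, while the bound with c = 1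
    reads 12 * form <= 60. *)
Lemma no_wheel4 x p q r s : a x p -> a x q -> a x r -> a x s ->
  a p q -> a q r -> a r s -> a p s -> p != r -> q != s -> False.
Proof.
move=> xp xq xr xs pq qr rs ps npr nqs.
have apr : a p r = false by apply/negP => pr; exact: (no_K4 xp xq xr).
have aqs : a q s = false by apply/negP => qs; exact: (no_K4 xp xq xs).
have := form_bound (shift (shift (shift (shift (shift
  (chi set0) 1 s) 1 r) 1 q) 1 p) 1 x) 1.
rewrite !shiftE xp xq xr xs pq qr rs ps apr aqs (negPf npr) (negPf nqs).
rewrite !(adj_neq xp, adj_neq xq, adj_neq xr, adj_neq xs,
  adj_neq pq, adj_neq qr, adj_neq rs, adj_neq ps).
by vm_compute.
Qed.

(** Weight 2 on the hub and 1 on the rim has total 7 and form 2 (5 + 5 * 2) - 2 (4 + 5) = 12: it is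
    a root. *)
Lemma no_wheel5 x p q r s t :
  a x p -> a x q -> a x r -> a x s -> a x t ->
  a p q -> a q r -> a r s -> a s t -> a p t ->
  p != r -> p != s -> q != s -> q != t -> r != t -> False.
Proof.
move=> xp xq xr xs xt pq qr rs st pt npr nps nqs nqt nrt.
have apr : a p r = false by apply/negP => pr; exact: (no_K4 xp xq xr).
have aqs : a q s = false by apply/negP => qs; exact: (no_K4 xq xr xs).
have art : a r t = false by apply/negP => rt; exact: (no_K4 xr xs xt).
have aps : a p s = false.
  by apply/negP => ps; apply: (no_K4 xp xs xt).
have aqt : a q t = false.
  by apply/negP => qt; apply: (no_K4 xp xq xt).
apply: (@no_root (shift (shift (shift (shift (shift (shift
  (chi set0) 1 t) 1 s) 1 r) 1 q) 1 p) 2 x)).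
  by rewrite !shiftE.
rewrite !shiftE xp xq xr xs xt pq qr rs st pt apr aqs art aps aqt.
rewrite (negPf npr) (negPf nps) (negPf nqs) (negPf nqt) (negPf nrt).
rewrite !(adj_neq xp, adj_neq xq, adj_neq xr, adj_neq xs, adj_neq xt,
  adj_neq pq, adj_neq qr, adj_neq rs, adj_neq st, adj_neq pt).
by vm_compute.
Qed.

(** * Edges among the common neighbours of two non-adjacent vertices *)

(** Twice the number of edges spanned by the common neighbours. *)
Definition common_deg v x := (\sum_(w in nbr x :&: nbr v)
  #|nbr w :&: (nbr x :&: nbr v)|)%N.

(* The weight 3x + 3v + M gives a bound strictly below 8; keeping the
   contribution of M to the window sum improves it to 6. *)
Lemma common_deg_le6 x v : x != v -> ~~ a x v -> (common_deg v x <= 6)%N.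
Proof.
move=> xv naxv; set M := nbr x :&: nbr v.
have cM : #|M| = 12%N by apply: mu.
have xM : nbr x :&: M = M by apply/setIidPr/subsetIl.
have vM : nbr v :&: M = M by apply/setIidPr/subsetIr.
have ixM : (x \in M) = false by rewrite !inE a_irr.
have ivM : (v \in M) = false by rewrite !inE a_irr andbF.
pose f := shift (shift (chi M) 3 v) 3 x.
have E : \sum_(z in M) lapl (chi M) z = (common_deg v x)%:R - 24.
  rewrite /common_deg -/M natr_sum.
  have -> : (24 : int) = \sum_(z in M) 2 by rewrite sumr_const cM.
  by rewrite -sumrB; apply: eq_bigr => z zM; rewrite lapl_chi zM.
have Ff : form f = 84 + (common_deg v x)%:R.
  rewrite !shiftE (negPf naxv) (negPf xv) form_chi E !lapl_chi xM vM ixM ivM cM.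
  lia.
have := sum_window f 5.
rewrite Ff !total_shift total_chi cM.
(* If z in [M] has n neighbours in [M], then [lapl f z] is n + 4 and its window term (n - 1)(n - 2)
   is at least 2 - 2n, the chord through n = 0 and n = 1. The window sum being 90 - 12 E with E =
   [common_deg v x], this gives 10 E <= 66. *)
suff : 24 - 2 * (common_deg v x)%:R <=
    \sum_z (lapl f z - 5) * (lapl f z - 5 - 1).
  by move: (\sum_z _) => q; lia.
have -> : 24 - 2 * (common_deg v x)%:R =
    \sum_(z in M) (- 2 - 2 * lapl (chi M) z).
  by rewrite sumrB -mulr_sumr E sumr_const cM; lia.
rewrite big_mkcond; apply: ler_sum => z _.
case: ifP => zM; last exact: window_ge0.
have [axz avz] : a x z /\ a v z by move: zM; rewrite !inE => /andP.
rewrite !lapl_shift lapl_chi zM !(a_sym z) axz avz ![z == _]eq_sym.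
rewrite !(adj_neq axz, adj_neq avz).
case: #|_| => [|n] //.
have : 0 <= (n : int) by [].
by move: (n : int) => k; nia.
Qed.

(* In the positive semidefinite form 2 - A + (2/7) J, f has the norm 16/7 of a
   vertex and total 1 modulo 7, and is congruent to w modulo the radical. *)
Lemma weight_vertex f : total f = 8 -> form f = 16 ->
  exists w, forall z, lapl f z = 2 + (a z w)%:R - 2 * (z == w)%:R.
Proof.
move=> s8 F16.
(* Otherwise every value is 2 or 3: the value 1 would make f - z a root, and values above 3 violate
   the bound for f + z. Then the window sum at c = 2 is 0, whereas it equals 6. *)
have [w gw] : exists w, lapl f w <= 0.
  case: (pickP [pred w | lapl f w <= 0]) => [w /= gw|g0]; first by exists w.
  have := sum_window f 2; rewrite s8 F16 big1 => [|z _]; first by lia.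
  have g1 : lapl f z != 1.
    apply/eqP => g1; apply: (@no_root (shift f (-1) z)).
      by rewrite total_shift s8.
    by rewrite form_shift F16 g1.
  have := form_bound (shift f 1 z) 2; rewrite total_shift form_shift s8 F16.
  move: (g0 z) => /= gz gz3.
  have /orP[/eqP->|/eqP->] // : (lapl f z == 2) || (lapl f z == 3).
  by move: gz g1 gz3; move: (lapl f z) => g; lia.
exists w.
pose f' := shift f (-1) w.
have s7 : total f' = 7 by rewrite total_shift s8.
have F14 : form f' = 14.
  have := form_bound f' 2; rewrite s7 form_shift F16; lia.
(* For total 7 and form 14 the mean of [lapl f'] is 2 and its variance is 0, so [lapl f'] is
   constantly 2. *)
have g2 : \sum_z (lapl f' z - 2) ^+ 2 = 0.
  have -> : \sum_z (lapl f' z - 2) ^+ 2 =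
      \sum_z (lapl f' z - 2) * (lapl f' z - 2 - 1) + total (lapl f')
        - 2 * \sum_(z : V) 1.
    rewrite /total mulr_sumr -big_split -sumrB.
    by apply: eq_bigr => z _ /=; ring.
  rewrite sum_window total_lapl s7 F14 natr_card (eq_card (B := V)) // card_V.
  lia.
move=> z; have /psumr_eq0P E : \sum_z (lapl f' z - 2) ^+ 2 = 0 by [].
have := E (fun z _ => sqr_ge0 _) z isT.
move/eqP; rewrite sqrf_eq0 lapl_shift; lia.
Qed.


(** * Second neighbours inside a neighbourhood, and its bipartition *)

Lemma triangle_indep x y z t : a x y -> z \in nbr x :&: nbr y ->
  t \in nbr x :&: nbr y -> ~~ a z t.
Proof.
move=> xy; rewrite !inE => /andP[xz yz] /andP[xt yt].
by apply/negP => zt; apply: (no_K4 xy xz xt yz yt zt).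
Qed.

Definition second x y := [set z in nbr x |
  [&& z != y, ~~ a z y & [exists u in nbr x :&: nbr y, a u z]]].

Lemma secondP x y z : reflect
  [/\ a x z, z != y, ~~ a z y & exists u, [/\ a x u, a y u & a u z]]
  (z \in second x y).
Proof.
rewrite !inE; apply: (iffP and4P) => [] [xz zy nazy].
  by move=> /exists_inP[u]; rewrite !inE => /andP[xu yu] uz; split=> //; exists u.
move=> [u [xu yu uz]]; split=> //.
by apply/exists_inP; exists u; rewrite ?inE ?xu.
Qed.

(** The vertex w is the one that [weight_vertex] attaches to the weight 2x + 2y + N, where N is the
    set of the 4 common neighbours of x and y. *)
Lemma second_vertex x y : a x y ->
  exists w, [/\ x != w, ~~ a x w & nbr x :&: nbr w = second x y].
Proof.
move=> xy; set N := nbr x :&: nbr y.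
have cN : #|N| = 4%N by apply: lambda.
have N0 z : z \in N -> nbr z :&: N = set0.
  move=> zN; apply/setP => u; rewrite [in RHS]inE in_setI; apply/negP.
  by rewrite inE => /andP[azu uN]; move: (triangle_indep xy zN uN); rewrite azu.
have xN : nbr x :&: N = N by apply/setIidPr/subsetIl.
have yN : nbr y :&: N = N by apply/setIidPr/subsetIr.
have ixN : (x \in N) = false by rewrite !inE a_irr.
have iyN : (y \in N) = false by rewrite !inE a_irr andbF.
pose f := shift (shift (chi N) 2 y) 2 x.
have sf : total f = 8 by rewrite !total_shift total_chi cN.
have Ff : form f = 16.
  rewrite !shiftE form_chi.
  have -> : \sum_(z in N) lapl (chi N) z = \sum_(z in N) (- 2).
    by apply: eq_bigr => z zN; rewrite lapl_chi N0 // cards0 zN.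
  rewrite sumr_const !lapl_chi xN yN ixN iyN cN xy (adj_neq xy).
  by vm_compute.
have [w fw] := weight_vertex sf Ff.
have [xw naxw] : x != w /\ ~~ a x w.
  have := fw x; rewrite !lapl_shift lapl_chi xN ixN cN xy (adj_neq xy) a_irr eqxx.
  by case: eqVneq => [<-|_]; [rewrite a_irr; lia | case: (a x w)].
exists w; split=> //.
(* For a neighbour z of x, [lapl f z] is 2 if z is y or lies in [N], and 2 plus the number of
   neighbours of z in [N] otherwise. By [fw], z is adjacent to w exactly when this value exceeds
   2. *)
apply/setP => z; rewrite in_setI [z \in nbr w]inE; apply/andP/secondP.
  rewrite inE => -[xz wz].
  have := fw z; rewrite (a_sym z) wz eq_sym (adj_neq wz).
  rewrite !lapl_shift lapl_chi (a_sym z x) xz [z == x]eq_sym (adj_neq xz).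
  case: (eqVneq z y) => [->|zy].
    by rewrite yN iyN cN a_irr; lia.
  case azy: (a z y).
    by rewrite N0 !inE xz a_sym azy ?cards0 //; lia.
  rewrite [z \in N]inE [z \in nbr y]inE a_sym azy andbF => h; split=> //.
  have /card_gt0P[u] : (0 < #|nbr z :&: N|)%N by lia.
  by rewrite !inE => /and3P[zu xu yu]; exists u; split; rewrite // a_sym.
move=> [xz zy nazy [u [xu yu uz]]]; rewrite inE xz; split=> //.
have := fw z; rewrite !lapl_shift lapl_chi.
rewrite (a_sym z x) xz [z == x]eq_sym (adj_neq xz) (negPf zy) (negPf nazy).
rewrite [z \in N]inE [z \in nbr y]inE a_sym (negPf nazy) andbF.
have : (0 < #|nbr z :&: N|)%N.
  by apply/card_gt0P; exists u; rewrite !inE xu yu a_sym uz.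
rewrite (a_sym w); case: (a z w) => //; case: eqP; lia.
Qed.

(** Let z and t be adjacent, reached from y through u and v. If u = v then x, u, z, t form a
    4-clique; otherwise y, u, z, t, v is a 5-cycle in the neighbourhood of x. *)
Lemma second_indep x y z t : a x y -> z \in second x y -> t \in second x y ->
  ~~ a z t.
Proof.
move=> xy /secondP[xz zy nzy [u [xu yu uz]]] /secondP[xt ty nty [v [xv yv vt]]].
apply/negP => zt; have [uv|uv] := eqVneq u v.
  by apply: (no_K4 xu xz xt uz _ zt); rewrite uv.
apply: (no_wheel5 xy xu xz xt xv yu uz zt) => //; first by rewrite a_sym.
- by rewrite eq_sym.
- by rewrite eq_sym.
- by apply: contra nty => /eqP <-; rewrite a_sym.
- by apply: contra nzy => /eqP ->; rewrite a_sym.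
Qed.

Definition far x := [set v | (x != v) && ~~ a x v].

Lemma card_far x : #|far x| = 72%N.
Proof.
have -> : far x = ~: (x |: nbr x).
  by apply/setP => v; rewrite !inE negb_or eq_sym.
have := cardsC (x |: nbr x); rewrite cardsU1 inE a_irr degree card_V.
by move=> h; apply/eqP; rewrite -(eqn_add2l 33) h.
Qed.

(** Counted from the ordered edges (z, y) inside [nbr x], of which there are 32 * 4: of the 4 common
    neighbours of z and y, one is x and the other 3 are far from x by [no_K4]. *)
Lemma sum_common_deg x : (\sum_(v in far x) common_deg v x = 384)%N.
Proof.
have E v z : (#|nbr z :&: (nbr x :&: nbr v)| =
    \sum_(y in nbr x :&: nbr z) a y v)%N.
  rewrite -big_mkcondr sum1dep_card; apply: eq_card => y.
  by rewrite !inE (a_sym y); case: (a z y); case: (a x y).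
rewrite /common_deg; under eq_bigr => v _ do under eq_bigr => z _ do rewrite E.
rewrite (exchange_big_dep (mem (nbr x))) /=; last by move=> v z _ /setIP[].
rewrite (eq_bigr (fun=> 12%N)) => [|z zx]; first by rewrite sum_nat_const degree.
rewrite exchange_big /= (eq_bigr (fun=> 3%N)) => [|y yxz].
  by rewrite sum_nat_const lambda //; move: zx; rewrite inE.
rewrite -big_mkcondr sum1dep_card.
move: zx yxz; rewrite !inE => xz /andP[xy zy].
have : #|nbr z :&: nbr y| = 4%N by apply: lambda.
rewrite (cardsD1 x) !inE !(a_sym _ x) xz xy => -[<-]; apply: eq_card => v.
rewrite !inE xz eq_sym (a_sym v z) -!andbA; case: eqVneq => //= vx.
case zv: (a z v); case yv: (a y v); rewrite ?andbF ?andbT //.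
by apply/negP => xv; apply: (no_K4 xz xy xv).
Qed.


Definition isolated x := [set w in far x | common_deg w x == 0%N].

(** The total 384 is spread, at most 6 each, over the non-isolated ones among the 72 far
    vertices. *)
Lemma card_isolated x : (#|isolated x| <= 8)%N.
Proof.
have := sum_common_deg x; rewrite (bigID (mem (isolated x))) /=.
rewrite big1 => [|v /andP[_]]; last by rewrite inE => /andP[_ /eqP].
rewrite add0n => S384.
suff : (384 <= (72 - #|isolated x|) * 6)%N by lia.
have -> : (72 - #|isolated x|)%N = #|far x :\: isolated x|.
  rewrite cardsD card_far (setIidPr _) //.
  by apply/subsetP => v; rewrite inE => /andP[].
rewrite -S384 -sum_nat_const.
rewrite [leqRHS](eq_bigl (fun v => (v \in far x) && (v \notin isolated x))).
  apply: leq_sum => v /andP[]; rewrite inE => /andP[xv naxv] _.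
  exact: common_deg_le6.
by move=> v; rewrite inE andbC.
Qed.

Definition opposite x w := [set y in nbr x | second x y == nbr x :&: nbr w].

(** Pigeonhole: each of the 32 neighbours of x is assigned by [second_vertex] to one of at most 8
    isolated vertices. *)
Lemma opposite_ge4 x : exists2 w, w \in isolated x & (4 <= #|opposite x w|)%N.
Proof.
apply/exists_inP; apply: contraT => /exists_inPn small.
suff : (32 <= #|isolated x| * 3)%N by have := card_isolated x; lia.
rewrite -(degree x) -sum_nat_const.
apply: (@leq_trans (\sum_(w in isolated x) #|opposite x w|)%N); last first.
  by apply: leq_sum => w /small; rewrite -ltnNge.
have E w : #|opposite x w| =
    (\sum_(y in nbr x) (second x y == nbr x :&: nbr w))%N.
  by rewrite -big_mkcondr sum1dep_card; apply: eq_card => y; rewrite !inE.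
under eq_bigr => w _ do rewrite E.
rewrite exchange_big /= -sum1_card; apply: leq_sum => y; rewrite inE => xy.
have [w [xw naxw sw]] := second_vertex xy.
rewrite (bigD1 w) /= ?sw ?eqxx // !inE xw naxw /=.
rewrite /common_deg sw big1 // => z zS; apply/eqP; rewrite cards_eq0.
apply/eqP/setP => t; rewrite [RHS]inE in_setI inE; apply/negP => /andP[zt tS].
by move: (second_indep xy zS tS); rewrite zt.
Qed.

(** Take P = K + M, where M consists of the 12 common neighbours of x and w and K of at least 4
    vertices opposite to w. P is independent and each of its vertices has 4 neighbours in [nbr x],
    while a vertex outside P has at most 4 in P; counting edges gives |P| <= 16, with equality
    everywhere. *)
Lemma bipartition x : exists w (P : {set V}),
  [/\ x != w, ~~ a x w, nbr x :&: nbr w \subset P, P \subset nbr x & #|P| = 16%N]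
  /\ {in P, forall u, #|nbr u :&: P| = 0%N} /\
     {in nbr x :\: P, forall u, #|nbr u :&: P| = 4%N}.
Proof.
have [w] := opposite_ge4 x; rewrite inE => /andP[].
rewrite inE => /andP[xw naxw] _ K4.
set K := opposite x w in K4; set M := nbr x :&: nbr w.
have cM : #|M| = 12%N by apply: mu.
have KP y : y \in K -> a x y /\ second x y = M.
  by rewrite !inE => /andP[xy /eqP].
have KM : K :&: M = set0.
  apply/setP => y; rewrite [RHS]inE inE; apply/negP => /andP[/KP[_ <-]].
  by case/secondP => _; rewrite eqxx.
have KMn y z : y \in K -> z \in M -> ~~ a z y.
  by move=> /KP[_ <-] /secondP[].
(* If y and z in [K] were adjacent, another neighbour u of z in [nbr x] would be at distance 2 from
   y, hence in [M], which has no edge to [K]. *)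
have KKn y z : y \in K -> z \in K -> ~~ a y z.
  move=> yK zK; apply/negP => yz; have [xy sy] := KP y yK; have [xz sz] := KP z zK.
  have : #|nbr x :&: nbr z| = 4%N by apply: lambda.
  rewrite (cardsD1 y) !inE xy a_sym yz add1n => -[c3].
  have /card_gt0P[u] : (0 < #|(nbr x :&: nbr z) :\ y|)%N by rewrite c3.
  rewrite !inE => /and3P[uy xu zu].
  suff : u \in M by move/(KMn _ _ zK); rewrite a_sym zu.
  rewrite -sy; apply/secondP; split=> //; last by exists z.
  by apply/negP => uy'; apply: (no_K4 xy xz xu yz _ zu); rewrite a_sym.
have [y0 y0K] : exists y, y \in K by apply/card_gt0P; apply: leq_trans K4.
have MMn y z : y \in M -> z \in M -> ~~ a y z.
  by have [xy0 <-] := KP _ y0K; apply: second_indep.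
pose P := K :|: M.
have PPn u : u \in P -> nbr u :&: P = set0.
  move=> uP; apply/setP => v; rewrite [RHS]inE inE; apply/negP => /andP[].
  rewrite [v \in nbr u]inE => uv; move: uv uP => /[swap].
  move=> /setUP[]uS + /setUP[]vS; apply/negP.
  - exact: KKn.
  - by rewrite a_sym; apply: KMn.
  - exact: KMn.
  - exact: MMn.
have PN : P \subset nbr x.
  rewrite subUset subsetIl andbT; apply/subsetP => y /KP[xy _].
  by rewrite inE.
have P16 : (16 <= #|P|)%N by rewrite cardsU KM cards0 cM; lia.
have PR : (#|nbr x :\: P| = 32 - #|P|)%N.
  by rewrite cardsD degree (setIidPr PN).
have edges : (\sum_(u in nbr x :\: P) #|nbr u :&: P| = #|P| * 4)%N.
  under eq_bigr => u _.
    rewrite (_ : #|nbr u :&: P| = \sum_(p in P) a u p)%N; last first.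
      rewrite -big_mkcondr sum1dep_card; apply: eq_card => p.
      by rewrite !inE andbC.
    over.
  rewrite exchange_big /= -sum_nat_const; apply: eq_bigr => p pP.
  rewrite -big_mkcondr sum1dep_card.
  have xp : a x p by move: (subsetP PN p pP); rewrite inE.
  rewrite -(lambda xp); apply: eq_card => u.
  rewrite [LHS]inE in_setD in_setI ![u \in nbr _]inE (a_sym u p).
  case uP : (u \in P) => //=; apply/esym/negP => /andP[_ pu].
  by have /setP/(_ u) := PPn p pP; rewrite in_setI uP !inE pu.
have le4 u : u \in nbr x :\: P -> (#|nbr u :&: P| <= 4)%N.
  rewrite inE => /andP[_]; rewrite inE => xu; rewrite -(lambda xu) setIC.
  by apply: subset_leq_card; apply: setSI.
have sum4 : (\sum_(u in nbr x :\: P) (4 - #|nbr u :&: P|) = 0)%N.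
  by rewrite sumnB // edges sum_nat_const PR; lia.
exists w, P; split; last split.
- split=> //; first exact: subsetUr.
  have : (#|P| * 4 <= (32 - #|P|) * 4)%N.
    by rewrite -edges -PR -sum_nat_const; apply: leq_sum.
  lia.
- by move=> u /PPn ->; rewrite cards0.
- move=> u uR; apply/eqP; rewrite eqn_leq le4 //= -subn_eq0.
  by move/eqP: sum4; rewrite sum_nat_eq0 => /forall_inP/(_ u uR).
Qed.

End StronglyRegular.

(** * Graph distance through bounded walks *)

Section Distance.

Variables (T : finType) (e : rel T).
Hypothesis e_sym : symmetric e.

Lemma within_refl n x : within e n x x.
Proof. by case: n => [|n] /=; rewrite eqxx. Qed.

Lemma within_cons n x y z : e x y -> within e n y z -> within e n.+1 x z.
Proof.
by move=> xy yz /=; apply/orP; right; apply/existsP; exists y; rewrite xy.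
Qed.

Lemma within_step n x y z : within e n x y -> e y z -> within e n.+1 x z.
Proof.
elim: n x => [|n IH] x.
  by move=> /eqP -> yz; apply: within_cons yz (within_refl _ _).
case/orP=> [/eqP->|/existsP[u /andP[xu uy]]] yz.
  exact: within_cons yz (within_refl _ _).
exact: within_cons xu (IH _ uy yz).
Qed.

Lemma within_sym n x y : within e n x y -> within e n y x.
Proof.
elim: n x => [|n IH] x; first by rewrite /= eq_sym.
case/orP=> [/eqP->|/existsP[u /andP[xu uy]]]; first exact: within_refl.
by apply: within_step (IH _ uy) _; rewrite e_sym.
Qed.

Lemma within_leq n m x y : n <= m -> within e n x y -> within e m x y.
Proof.
elim: n m x => [|n IH] m x.
  by move=> _ /eqP ->; exact: within_refl.
case: m => // m nm; case/orP=> [/eqP->|/existsP[u /andP[xu uy]]].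
  exact: within_refl.
exact: within_cons xu (IH _ _ nm uy).
Qed.

(** The hypothesis says that [find] succeeds: its default value on failure is #|T|. *)
Lemma gdist_leq n x y : gdist e x y < #|T| -> (gdist e x y <= n) = within e n x y.
Proof.
move=> ltT; have hasw : has (fun n => within e n x y) (iota 0 #|T|).
  by rewrite has_find size_iota.
apply/idP/idP => [le_n|wn].
  by apply: within_leq le_n _; have := nth_find 0 hasw; rewrite nth_iota.
rewrite leqNgt; apply/negP => lt_n.
have := before_find 0 lt_n; rewrite nth_iota ?add0n ?wn //.
exact: ltn_trans lt_n ltT.
Qed.

End Distance.

(** * Distances and intersection numbers of the cover *)

Section Cover.

Variables (T : finType) (e : rel T).
Hypothesis dr : distance_regular e [:: 32; 27; 9; 1] [:: 1; 3; 27; 32].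

Local Notation d := (gdist e).

Lemma e_sym : symmetric e. Proof. by case: dr => [[]]. Qed.
Lemma e_irr : irreflexive e. Proof. by case: dr => [[]]. Qed.

Lemma d_le4 x y : d x y <= 4. Proof. by case: dr => _ _ _ []. Qed.

Lemma card_out v w : d v w < 4 ->
  #|[set u | e w u & d v u == (d v w).+1]| = nth 0 [:: 32; 27; 9; 1] (d v w).
Proof. by case: dr => _ _ _ _ /(_ v w _ erefl)[]. Qed.

Lemma card_in v w : 0 < d v w ->
  #|[set u | e w u & d v u == (d v w).-1]| = nth 0 [:: 1; 3; 27; 32] (d v w).-1.
Proof. by case: dr => _ _ _ _ /(_ v w _ erefl)[_ H] dvw; apply: H; rewrite dvw d_le4. Qed.

Lemma d_xx x : d x x = 0.
Proof.
by rewrite /gdist (cardD1 x) inE /= eqxx.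
Qed.

(** Distances are at most 4, while x alone has 32 neighbours. *)
Lemma d_lt x y : d x y < #|T|.
Proof.
apply: leq_ltn_trans (d_le4 x y) _.
have := @card_out x x; rewrite d_xx => /(_ isT) /= c32.
apply: (@leq_trans 32) => //; rewrite -c32; exact: max_card.
Qed.

Lemma d_leq n x y : (d x y <= n) = within e n x y.
Proof. exact: gdist_leq (d_lt x y). Qed.

Lemma d_sym x y : d x y = d y x.
Proof.
by apply/eqP; rewrite eqn_leq !d_leq; apply/andP; split;
  apply: (within_sym e_sym); rewrite -d_leq.
Qed.

Lemma d_step x y z : e y z -> d x z <= (d x y).+1.
Proof. by move=> yz; rewrite d_leq; apply: within_step yz; rewrite -d_leq. Qed.

Lemma d_eq0 x y : (d x y == 0) = (x == y).
Proof. by rewrite -leqn0 d_leq. Qed.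

Lemma d_eq1 x y : (d x y == 1) = e x y.
Proof.
have [->|xy] := eqVneq x y; first by rewrite d_xx e_irr.
rewrite eqn_leq lt0n d_eq0 xy andbT d_leq /= (negPf xy) /=.
apply/existsP/idP => [[z /andP[xz /eqP <-]]//|xy'].
by exists y; rewrite xy' eqxx.
Qed.

Lemma card_deg x : #|[set y | e x y]| = 32.
Proof.
have := @card_out x x; rewrite d_xx => /(_ isT) /= <-.
by apply: eq_card => y; rewrite !inE d_eq1 andbb.
Qed.

Lemma d_nbr v w u : e w u ->
  [|| d v u == (d v w).-1, d v u == d v w | d v u == (d v w).+1].
Proof.
move=> wu; have := d_step v wu; have := @d_step v u w; rewrite e_sym => /(_ wu).
lia.
Qed.

(** The remaining intersection number a_i = 32 - b_i - c_i. The list of the c_i starts at i = 1,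
    hence the predecessor in its index. *)
Lemma card_same v w : 0 < d v w < 4 ->
  #|[set u | e w u & d v u == d v w]| +
    nth 0 [:: 32; 27; 9; 1] (d v w) + nth 0 [:: 1; 3; 27; 32] (d v w).-1 = 32.
Proof.
case/andP=> d0 d4; rewrite -card_out // -card_in // -[in RHS](card_deg w).
rewrite -!sum1dep_card !big_mkcondr -!big_split /=; apply: eq_bigr => u wu.
have := d_nbr v wu; do 3 case: eqP => ?; lia.
Qed.

Lemma card_same2 v w : d v w = 2 -> #|[set u | e w u & d v u == 2]| = 20.
Proof. by move=> vw; have := @card_same v w; rewrite vw => /(_ isT) /=; lia. Qed.

Lemma card_same3 v w : d v w = 3 -> #|[set u | e w u & d v u == 3]| = 4.
Proof. by move=> vw; have := @card_same v w; rewrite vw => /(_ isT) /=; lia. Qed.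

Lemma card_common1 v w : d v w = 1 -> #|[set u | e w u & e v u]| = 4.
Proof.
move=> vw; have := @card_same v w; rewrite vw => /(_ isT) /= h.
have <- : #|[set u | e w u & d v u == 1]| = 4 by lia.
by apply: eq_card => u; rewrite !inE d_eq1.
Qed.

Lemma card_common2 v w : d v w = 2 -> #|[set u | e w u & e v u]| = 3.
Proof.
move=> vw; have := @card_in v w; rewrite vw => /(_ isT) /= <-.
by apply: eq_card => u; rewrite !inE d_eq1.
Qed.

Lemma nbr_of_4 v w u : d v w = 4 -> e w u -> d v u = 3.
Proof.
move=> vw wu; have := @card_in v w; rewrite vw => /(_ isT) /=.
rewrite -(card_deg w) => /eqP.
have sub : [set u | e w u & d v u == 3] \subset [set u | e w u].
  by apply/subsetP => t; rewrite !inE => /andP[].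
by have /leqifP := subset_leqif_cards sub; case: ifP => [/eqP h _ _|_ /ltn_eqF -> //];
  move/setP/(_ u) : h; rewrite !inE wu /= => /eqP.
Qed.

(** Neighbours of y and z are at distance 3 from x. Distance 2 between y and z contradicts b_3 = 1
    at a common neighbour. For distance 3, take a path y, u, t, z: the 4 common neighbours of u and
    y already exhaust the a_3 = 4 neighbours of u at distance 3 from x, yet t is another one. *)
Lemma dist4_trans x y z : d x y = 4 -> d x z = 4 -> y != z -> d y z = 4.
Proof.
move=> xy xz yz.
have n0 : d y z != 0 by rewrite d_eq0.
have n1 : d y z != 1.
  by rewrite d_eq1; apply/negP => /(nbr_of_4 xy); rewrite xz.
have n2 : d y z != 2.
  apply/eqP => /card_common2 c3.
  have /card_gt0P[u] : 0 < #|[set u | e z u & e y u]| by rewrite c3.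
  rewrite !inE => /andP[zu yu]; have xu := nbr_of_4 xy yu.
  have := @card_out x u; rewrite xu => /(_ isT) /= c1.
  have : [set y; z] \subset [set t | e u t & d x t == 4].
    by apply/subsetP => t /set2P[]->; rewrite inE e_sym ?yu ?zu ?xy ?xz.
  by move/subset_leq_card; rewrite c1 cards2 yz.
have n3 : d y z != 3.
  apply/eqP => yz3; have := @card_in y z; rewrite yz3 => /(_ isT) /= c27.
  have /card_gt0P[t] : 0 < #|[set t | e z t & d y t == 2]| by rewrite c27.
  rewrite inE => /andP[zt /eqP yt]; have xt := nbr_of_4 xz zt.
  have /card_gt0P[u] : 0 < #|[set u | e t u & e y u]| by rewrite card_common2.
  rewrite !inE => /andP[tu yu]; have xu := nbr_of_4 xy yu.
    have yu1 : d y u = 1 by apply/eqP; rewrite d_eq1.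
  have sub : [set s | e u s & e y s] \subset [set s | e u s & d x s == 3].
    apply/subsetP => s; rewrite !inE => /andP[-> ys] /=.
    by apply/eqP; exact: nbr_of_4 xy ys.
  have /eqP/setP/(_ t) : [set s | e u s & e y s] == [set s | e u s & d x s == 3].
    by rewrite eqEcard sub card_common1 // card_same3.
  by rewrite !inE e_sym tu xt -d_eq1 yt.
by have := d_le4 y z; lia.
Qed.

(** * Antipodal classes and the folded graph *)

Definition antipodal x y := (d x y == 0) || (d x y == 4).

Lemma antipodal_refl x : antipodal x x.
Proof. by rewrite /antipodal d_xx. Qed.

Lemma antipodal_sym x y : antipodal x y = antipodal y x.
Proof. by rewrite /antipodal d_sym. Qed.

Lemma antipodal_trans x y z : antipodal x y -> antipodal x z -> antipodal y z.
Proof.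
rewrite /antipodal !d_eq0.
move=> /orP[/eqP->//|/eqP xy] /orP[/eqP<-|/eqP xz]; first by rewrite d_sym xy orbT.
by have [//|yz] := eqVneq y z; rewrite (dist4_trans xy xz yz) orbT.
Qed.

Definition fold_adj x y := (d x y == 1) || (d x y == 3).

Lemma fold_adj_sym x y : fold_adj x y = fold_adj y x.
Proof. by rewrite /fold_adj d_sym. Qed.

Lemma fold_adj_opposite x z : d x z = 3 ->
  exists2 y, e x y & d z y = 4.
Proof.
move=> xz; have := @card_out z x; rewrite d_sym xz => /(_ isT) /= c1.
have /card_gt0P[y] : 0 < #|[set y | e x y & d z y == 4]| by rewrite c1.
by rewrite inE => /andP[xy /eqP]; exists y.
Qed.

(** Adjacency descends to antipodal classes: if x is at distance 1 or 3 from z, then x has a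
    neighbour in the class of z and is at distance 3 from the other members. *)
Lemma fold_adj_antipodal x z t : antipodal z t -> fold_adj x z -> fold_adj x t.
Proof.
move=> /orP[|/eqP zt]; first by rewrite d_eq0 => /eqP ->.
move=> xz; case/orP: (xz) => [|/eqP xz3].
  rewrite d_eq1 e_sym => zx; rewrite /fold_adj d_sym.
  by rewrite (@nbr_of_4 t z x) ?orbT // d_sym.
have [y xy zy] := fold_adj_opposite xz3.
rewrite /fold_adj d_eq1; have [<-|yt] := eqVneq y t; first by rewrite xy.
rewrite d_sym (@nbr_of_4 t y x) ?orbT //; last by rewrite e_sym.
by rewrite d_sym; apply: dist4_trans zy zt yt.
Qed.


(* The folded graph: its vertices are the chosen representatives of the antipodal
   classes. *)
Definition rep x := odflt x [pick y | antipodal x y].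

Lemma rep_antipodal x : antipodal x (rep x).
Proof. by rewrite /rep; case: pickP => //= _; exact: antipodal_refl. Qed.

Lemma rep_eq x y : antipodal x y -> rep x = rep y.
Proof.
move=> xy; rewrite /rep.
have E : antipodal x =1 antipodal y.
  by move=> z; apply/idP/idP => ?; apply: antipodal_trans; eauto;
    rewrite antipodal_sym.
rewrite (eq_pick E); case: pickP => // /(_ y).
by rewrite antipodal_refl.
Qed.

Lemma rep_rep x : rep (rep x) == rep x.
Proof. by rewrite -(rep_eq (rep_antipodal x)). Qed.

Definition folded := {x : T | rep x == x}.

Definition fold x : folded := exist _ (rep x) (rep_rep x).

Definition fadj (u v : folded) := fold_adj (val u) (val v).

Lemma val_fold x : val (fold x) = rep x. Proof. by []. Qed.

Lemma foldK (u : folded) : fold (val u) = u.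
Proof. by apply: val_inj; rewrite val_fold; exact/eqP/(valP u). Qed.

Lemma fold_eq x y : (fold x == fold y) = antipodal x y.
Proof.
apply/eqP/idP => [/(congr1 val)|xy]; last by apply: val_inj; exact: rep_eq.
rewrite !val_fold => xy; apply: (@antipodal_trans (rep x)).
  by rewrite antipodal_sym rep_antipodal.
by rewrite xy antipodal_sym rep_antipodal.
Qed.

Lemma fadj_fold x y : fadj (fold x) (fold y) = fold_adj x y.
Proof.
rewrite /fadj !val_fold; apply/idP/idP => h.
  apply: (@fold_adj_antipodal x (rep y)).
    by rewrite antipodal_sym rep_antipodal.
  rewrite fold_adj_sym; apply: (@fold_adj_antipodal (rep y) (rep x)).
    by rewrite antipodal_sym rep_antipodal.
  by rewrite fold_adj_sym.
apply: (@fold_adj_antipodal (rep x) y); first exact: rep_antipodal.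
rewrite fold_adj_sym; apply: (@fold_adj_antipodal y x); first exact: rep_antipodal.
by rewrite fold_adj_sym.
Qed.

Lemma d_common x y z : e x y -> e x z -> d y z <= 2.
Proof.
move=> xy xz; apply: leq_trans (d_step y xz) _.
by rewrite ltnS d_sym leq_eqVlt d_eq1 xy.
Qed.

(** Folding maps the neighbours of x bijectively onto those of its class: two neighbours of x are at
    distance at most 2, so never antipodal. *)
Lemma card_fold x (Q : pred folded) :
  #|[set v | fadj (fold x) v & Q v]| = #|[set y | e x y & Q (fold y)]|.
Proof.
rewrite -(@card_in_imset _ _ fold [set y | e x y & Q (fold y)]); last first.
  move=> y z; rewrite !inE => /andP[xy _] /andP[xz _] /eqP.
  rewrite fold_eq => /orP[|/eqP yz4]; first by rewrite d_eq0 => /eqP.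
  by have := d_common xy xz; rewrite yz4.
apply: eq_card => v; rewrite inE; apply/andP/imsetP => [[xv Qv]|[y]].
  have [y xy yv] : exists2 y, e x y & fold y = v.
    move: xv; rewrite -(foldK v) fadj_fold => xv.
    case/orP: (xv) => [|/eqP /fold_adj_opposite[y xy vy]].
      by rewrite d_eq1; exists (val v).
    exists y => //; apply/eqP; rewrite fold_eq antipodal_sym.
    by rewrite /antipodal vy orbT.
  by exists y; rewrite // inE xy yv.
rewrite inE => /andP[xy Qy] ->; split=> //.
by rewrite fadj_fold /fold_adj d_eq1 xy.
Qed.

Lemma fadj_sym : symmetric fadj.
Proof. by move=> u v; rewrite /fadj fold_adj_sym. Qed.

Lemma fadj_irr : irreflexive fadj.
Proof. by move=> u; rewrite /fadj /fold_adj d_xx. Qed.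

Lemma fadj_degree u : #|nbr fadj u| = 32.
Proof.
rewrite -(card_deg (val u)) -[u in LHS]foldK.
transitivity #|[set v | fadj (fold (val u)) v & predT v]|.
  by apply: eq_card => v; rewrite !inE andbT.
by rewrite card_fold; apply: eq_card => v; rewrite !inE andbT.
Qed.

Lemma fadj_common u v : #|nbr fadj u :&: nbr fadj v| =
  #|[set y | e (val u) y & fold_adj (val v) y]|.
Proof.
rewrite -[u in LHS]foldK -[v in LHS]foldK.
transitivity #|[set w | fadj (fold (val u)) w & fadj (fold (val v)) w]|.
  by apply: eq_card => w; rewrite !inE.
by rewrite card_fold; apply: eq_card => y; rewrite !inE fadj_fold.
Qed.

(** Lifts are at distance 1 or 3; distance parity leaves only the a_1 = 4 or a_3 = 4 neighbours at
    that same distance. *)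
Lemma fadj_lambda u v : fadj u v -> #|nbr fadj u :&: nbr fadj v| = 4.
Proof.
rewrite fadj_sym fadj_common => /orP[] /eqP uv.
  rewrite -(card_common1 uv); apply: eq_card => y; rewrite !inE.
  case uy : (e (val u) y) => //=; rewrite /fold_adj -d_eq1.
  by have := d_nbr (val v) uy; rewrite uv => /or3P[] /eqP ->.
rewrite -(card_same3 uv); apply: eq_card => y; rewrite !inE.
case uy : (e (val u) y) => //=; rewrite /fold_adj.
by have := d_nbr (val v) uy; rewrite uv => /or3P[] /eqP ->.
Qed.

Lemma far_dist2 u v : u != v -> ~~ fadj u v -> d (val u) (val v) = 2.
Proof.
rewrite -{1}(foldK u) -{1}(foldK v) fold_eq /antipodal /fadj /fold_adj.
by have := d_le4 (val u) (val v); case: (d _ _) => [|[|[|[|[|n]]]]].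
Qed.

(** Lifts are at distance 2, so exactly the a_2 = 20 neighbours at distance 2 are discarded from
    32. *)
Lemma fadj_mu u v : u != v -> ~~ fadj u v -> #|nbr fadj u :&: nbr fadj v| = 12.
Proof.
move=> uv nuv; have := far_dist2 uv nuv; rewrite fadj_common d_sym => vu2.
have := card_deg (val u).
rewrite -(cardsID [set y | d (val v) y == 2]).
have -> : [set y | e (val u) y] :&: [set y | d (val v) y == 2] =
    [set y | e (val u) y & d (val v) y == 2] by apply/setP => y; rewrite !inE.
rewrite (card_same2 vu2) => h.
have -> : [set y | e (val u) y & fold_adj (val v) y] =
    [set y | e (val u) y] :\: [set y | d (val v) y == 2]; last first.
  by apply/eqP; rewrite -(eqn_add2l 20) h.
apply/setP => y; rewrite !inE andbC; case uy : (e (val u) y); rewrite ?andbF //.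
by have := d_nbr (val v) uy; rewrite vu2 /fold_adj => /or3P[] /eqP ->.
Qed.

(** * Counting in the cover and the contradiction *)

Lemma card_sphere2 x : #|[set v | d x v == 2]| = 288.
Proof.
suff : #|[set v | d x v == 2]| * 3 = 32 * 27 by lia.
rewrite -sum_nat_const -(card_deg x) -sum_nat_const.
transitivity (\sum_(v in [set v | d x v == 2]) \sum_(y in [set y | e x y]) e v y).
  apply: eq_bigr => v; rewrite inE => /eqP /card_common2 <-.
  rewrite -big_mkcondr sum1dep_card; apply: eq_card => y.
  by rewrite !inE andbC.
rewrite exchange_big; apply: eq_bigr => y; rewrite inE => xy.
rewrite -big_mkcondr sum1dep_card.
have := @card_out x y; rewrite (eqP (_ : d x y == 1)) ?d_eq1 // => /(_ isT) /= <-.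
by apply: eq_card => v; rewrite !inE e_sym andbC.
Qed.

Lemma no_cover : False.
Proof.
have [x1 _] : exists x y, d x y = 4 by case: dr => _ _ _ [].
pose X := fold x1; pose x := val X.
have [w [P [[Xw naXw XwP PX P16] [P0 P4]]]] := bipartition X fadj_sym fadj_irr
  fadj_degree fadj_lambda fadj_mu X.
have fx y : e x y -> fold y \in nbr fadj X.
  by move=> xy; rewrite inE -(foldK X) fadj_fold /fold_adj d_eq1 xy.
pose L := [set y | e x y & fold y \in P].
have xL y : y \in L -> e x y by rewrite inE => /andP[].
have L16 : #|L| = 16.
  rewrite -P16 -card_fold foldK; apply: eq_card => v; rewrite !inE.
  by apply: andb_idl => /(subsetP PX); rewrite inE.
(* A neighbour y of u with [fold y] in [P] is at distance 1 or 3 from x but also at most 2, hence it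
   lies in [L]. *)
have degL u : e x u -> #|[set y | e u y & y \in L]| = #|nbr fadj (fold u) :&: P|.
  move=> xu; transitivity #|[set v | fadj (fold u) v & v \in P]|; last first.
    by apply: eq_card => v; rewrite !inE.
  rewrite card_fold; apply: eq_card => y; rewrite !inE.
  case uy : (e u y) => //=; apply: andb_idl => yP.
  have := subsetP PX _ yP; rewrite inE -(foldK X) fadj_fold /fold_adj d_eq1.
  case/orP => // /eqP xy3; have := @d_common u x y; rewrite e_sym xu xy3.
  by move=> /(_ isT uy).
pose j v := \sum_(y in L) e v y.
have jE v : j v = #|[set y | e v y & y \in L]|.
  by rewrite /j -big_mkcondr sum1dep_card; apply: eq_card => y; rewrite !inE andbC.
have jx : j x = 16.
  rewrite jE -L16; apply: eq_card => y; rewrite !inE.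
  by case: (e x y).
have jL u : u \in L -> j u = 0.
  by rewrite inE => /andP[xu uP]; rewrite jE degL // P0.
have jR u : u \in [set u | e x u] :\: L -> j u = 4.
  rewrite !inE => /andP[uL xu]; rewrite jE degL // P4 // inE fx //.
  by move: uL; rewrite xu /= => ->.
(* Distinct vertices of [L] are non-adjacent neighbours of x, so they have c_2 = 3 common
   neighbours; 3 + 29 is the degree. *)
have common p q : p \in L -> q \in L -> \sum_v e v p * e v q = 3 + 29 * (p == q).
  move=> pL qL.
  have -> : \sum_v e v p * e v q = #|[set v | e q v & e p v]|.
    rewrite -sum1dep_card [RHS]big_mkcond; apply: eq_bigr => v _ /=.
    by rewrite !(e_sym v); case: (e p v); case: (e q v).
  have [<-|pq] := eqVneq p q.
    by rewrite (_ : 3 + _ = 32) // -(card_deg p); apply: eq_card => v; rewrite !inE andbb.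
  apply: card_common2.
  have := d_common (xL _ pL) (xL _ qL).
  suff : ~~ e p q by rewrite -d_eq1; move: pq; rewrite -d_eq0; lia.
  apply/negP => epq; have := jL p pL; rewrite /j (bigD1 q) //= epq.
  by [].
have S1 : \sum_v j v = 512.
  rewrite exchange_big /= (eq_bigr (fun=> 32)) ?sum_nat_const ?L16 // => y _.
  rewrite -(card_deg y) -sum1dep_card [RHS]big_mkcond; apply: eq_bigr => v _ /=.
  by rewrite e_sym.
have S2 : \sum_v j v ^ 2 = 1232.
  transitivity (\sum_(p in L) \sum_(q in L) \sum_v e v p * e v q).
    under [RHS]eq_bigr => p _ do rewrite exchange_big /=.
    rewrite [RHS]exchange_big /=.
    apply: eq_bigr => v _; rewrite -mulnn /j big_distrl; apply: eq_bigr => p _ /=.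
    by rewrite big_distrr.
  transitivity (\sum_(p in L) (16 * 3 + 29)).
    apply: eq_bigr => p pL; rewrite (eq_bigr _ (fun q => common p q pL)).
    rewrite big_split /= sum_nat_const L16 (bigD1 p) //= eqxx big1 // => q.
    by rewrite eq_sym => /andP[_ /negPf ->].
  by rewrite sum_nat_const L16.
pose G := [set v | d x v == 2].
(* [j] is 16 at x, 0 on [L], 4 on the other 16 neighbours of x, and 0 beyond distance 2. *)
have split2 (h : nat -> nat) : h 0 = 0 ->
    \sum_v h (j v) = h 16 + 16 * h 4 + \sum_(v in G) h (j v).
  move=> h0; rewrite (bigD1 x) //= jx -addnA; congr (_ + _).
  have R16 : #|[set u | e x u] :\: L| = 16.
    rewrite cardsD card_deg (setIidPr _) ?L16 //.
    by apply/subsetP => y /xL; rewrite inE.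
  rewrite (bigID (mem ([set u | e x u] :\: L))) /=; congr (_ + _).
    rewrite -[X in _ = X * _]R16 -sum_nat_const; apply: eq_big => [v|v].
      by rewrite !inE andb_idl // => /andP[_]; apply: contraTneq => ->; rewrite e_irr.
    by move=> /andP[_ /jR ->].
  rewrite [LHS]big_mkcond [RHS]big_mkcond; apply: eq_bigr => v _ /=.
  have [vL|vL] := boolP (v \in L).
    by rewrite jL // h0; case: ifP; case: ifP.
  rewrite !inE in vL *; rewrite vL /=.
  have [->|vx] := eqVneq v x; first by rewrite d_xx.
  rewrite -d_eq1 /=.
  have [d2|nd2] := eqVneq (d x v) 2; first by rewrite d2.
  case: eqVneq => //= nd1.
  suff -> : j v = 0 by [].
  rewrite /j big1 // => y yL; apply/eqP; rewrite eqb0; apply/negP => vy.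
  have := d_step x (etrans (e_sym y v) vy); rewrite (eqP (_ : d x y == 1)) ?d_eq1 ?xL //.
  by move: vx; rewrite eq_sym -d_eq0; lia.
have G1 := split2 id erefl; have G2 := split2 (expn^~ 2) erefl.
rewrite /= S1 in G1; rewrite /= S2 in G2.
pose v := val w.
have xv : d x v = 2 by exact: far_dist2.
have vG : v \in G by rewrite inE xv.
(* The 3 common neighbours of x and v fold to common neighbours of [X] and w, which all lie in
   [P]. *)
have jv : 3 <= j v.
  rewrite jE -(card_common2 xv); apply: subset_leq_card; apply/subsetP => y.
  rewrite !inE => /andP[vy xy]; rewrite vy xy /=; apply: (subsetP XwP).
  by rewrite inE fx // inE -(foldK w) fadj_fold /fold_adj d_eq1 -/v vy.
(* This is (j - 1)(j - 2) >= 0, strict at v. But over [G] the sum of j is 512 - 16 - 64 = 432 and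
   that of j^2 is 1232 - 256 - 256 = 720, so both sides equal 1296. *)
have : \sum_(u in G) 3 * j u < \sum_(u in G) (j u ^ 2 + 2).
  rewrite (bigD1 v) //= [ltnRHS](bigD1 v) //= -addSn; apply: leq_add; first by nia.
  by apply: leq_sum => u _; case: (j u) => [|[|[|k]]] //; nia.
rewrite -big_distrr big_split /= sum_nat_const card_sphere2; lia.
Qed.

End Cover.

Theorem theorem4p8 :
  forall (T : finType) (e : rel T),
    ~ distance_regular e [:: 32; 27; 9; 1] [:: 1; 3; 27; 32].
Proof. exact: no_cover. Qed.
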